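(* Let $R$ be a finite indecomposable commutative ring and $\Pi=\prod_{i\in\omega}Re_i$. Then there exists a unital $\eta\in\operatorname{End}(\Pi)$ such that $\eta$ is an $n$-local automorphism of $\Pi$ for all integers $n>0$, but $\eta$ is not surjective. In particular, $\eta$ is not an $R$-algebra automorphism of $\Pi$.
   Context: A commutative ring $R$ with identity is indecomposable if $0\ne1$ and $0,1$ are its only idempotents. $\Pi=\prod_{i\in\omega}Re_i$ is the full cartesian product of countably infinitely many copies of $R$, an $R$-algebra with componentwise operations. $\operatorname{End}(\Pi)$ is the set of $R$-algebra endomorphisms of $\Pi$ ($R$-linear multiplicative maps, not necessarily unital); unital means $\eta(1)=1$. An $n$-local automorphism of $\Pi$ is an $R$-linear map $\eta:\Pi\to\Pi$ such that for all $a_1,\dots,a_n\in\Pi$ there is an $R$-algebra automorphism $\varphi$ of $\Pi$ with $\eta(a_i)=\varphi(a_i)$ for all $1\le i\le n$. *)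

(* Defs.v *)
From HB Require Import structures.
From mathcomp Require Import all_boot all_algebra.
From mathcomp Require Import boolp classical_sets functions.

Set Implicit Arguments.
Unset Strict Implicit.
Unset Printing Implicit Defensive.

Import GRing.Theory.
Local Open Scope ring_scope.

Definition indecomposable (R : comPzRingType) : Prop :=
  (0 : R) != 1 /\ forall e : R, e * e = e -> e = 0 \/ e = 1.

Definition Pi (R : comNzRingType) : Type := nat -> R^o.

HB.instance Definition _ (R : comNzRingType) :=
  GRing.ComNzRing.copy (Pi R) (nat -> R^o).
HB.instance Definition _ (R : comNzRingType) :=
  GRing.Lmodule.copy (Pi R) (nat -> R^o).

Fact Pi_scalerAl (R : comNzRingType) (c : R) (x y : Pi R) :
  c *: (x * y) = c *: x * y.
Proof. by apply/funext => i; exact: mulrA. Qed.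

HB.instance Definition _ (R : comNzRingType) :=
  GRing.Lmodule_isLalgebra.Build R (Pi R) (@Pi_scalerAl R).
HB.instance Definition _ (R : comNzRingType) :=
  GRing.Lalgebra_isComAlgebra.Build R (Pi R).

Section AlgebraMaps.
Variables (R : comNzRingType) (A : algType R).
Implicit Types f : A -> A.

(* Endomorphisms need not be unital; unitality of a bijective one is
   automatic. *)
Definition alg_endomorphism f : Prop :=
  linear f /\ {morph f : x y / x * y}.

Definition alg_automorphism f : Prop :=
  alg_endomorphism f /\ bijective f.

Definition local_automorphism (n : nat) f : Prop :=
  linear f /\
  forall a : 'I_n -> A, exists phi : A -> A,
    alg_automorphism phi /\ forall i, f (a i) = phi (a i).

End AlgebraMaps.

(* Main.v *)
Require Import Defs.
From mathcomp Require Import all_boot all_algebra.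
From mathcomp Require Import boolp classical_sets functions filter.
Local Open Scope ring_scope.

(** Let [U] be a nonprincipal ultrafilter on the naturals.  As [R] is finite,
    every sequence in [R] has a [U]-limit, and [eta] shifts a sequence one step
    to the right and puts its [U]-limit in the freed coordinate 0.  It is not
    onto, because [eta x] is constantly 0 as soon as its shift is.  Given
    finitely many sequences, the set [S] of indices at which each of them takes
    its limit value belongs to [U], hence is infinite.  A permutation of the
    naturals that moves one extra point into [S] then realizes [eta] on these
    sequences. *)

(** The ultrafilter is used only here; later, identities for [L] are read off at one index where all
    the sequences involved take their limits. *)
Lemma ultralimit (T : finType) : exists L : (nat -> T) -> T,
  forall n (a : 'I_n -> nat -> T) N,
    exists2 i, (N <= i)%N & forall j, a j i = L (a j).
Proof.
have [U [UU leU]] := ultraFilterLemma eventually_filter.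
have limP (x : nat -> T) : exists r, U (fun i => x i = r).
  apply: contrapT => /forallNP nU.
  (* Otherwise the finitely many complements meet in a member of [U], and any [i] in it fails at
     [r = x i]. *)
  have : \forall i \near U, forall r, x i <> r.
    apply: filter_forall => r.
    by have [/nU|] := in_ultra_setVsetC (fun i => x i = r) UU.
  by move=> /filter_ex[i /(_ (x i))].
have [L LP] := choice limP.
exists L => n a N.
have : \forall i \near U, (N <= i)%N /\ forall j, a j i = L (a j).
  apply: filterI; last by apply: filter_forall => j; exact: LP.
  by apply: leU; exists N.
by move=> /filter_ex[i [? ?]]; exists i.
Qed.

Section PermInsert.
Variable S : pred nat.
Hypothesis S_unbounded : forall N, exists i, (N <= i)%N && S i.

Let next N := ex_minn (S_unbounded N).

(* The permutation sends 0 and each [s.+1] with [s] in [S] to the next element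
   of [S], and [i.+1] to [i] otherwise; on [S] its inverse is [after_prev]. *)
Fixpoint after_prev j :=
  if j is i.+1 then if S i then j else after_prev i else 0%N.

(** [after_prev j] is one more than the largest element of [S] below [j], or 0 if there is none. *)
Lemma after_prevP j : [/\ (after_prev j <= j)%N,
  forall k, (after_prev j <= k < j)%N -> ~~ S k
  & (after_prev j == 0%N) || S (after_prev j).-1].
Proof.
elim: j => [|j [le_j notS ?]] /=; first by split => // k; rewrite ltn0 andbF.
case: ifPn => [Sj|nSj].
  by split; rewrite //= ?Sj // => k /andP[/leq_ltn_trans/[apply]]; rewrite ltnn.
split; rewrite ?(leqW le_j) // => k /andP[le_k].
rewrite ltnS leq_eqVlt => /predU1P[->//|lt_k].
by apply: notS; rewrite le_k.
Qed.

(** Of two distinct candidates, the larger would have its predecessor in [S], inside the gap that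
    the smaller leaves free of [S]. *)
Lemma after_prev_unique m j : (m <= j)%N ->
  (forall k, (m <= k < j)%N -> ~~ S k) -> (m == 0%N) || S m.-1 ->
  after_prev j = m.
Proof.
have [le_p notSp Sp] := after_prevP j => le_m notSm Sm.
case: (ltngtP (after_prev j) m) => // lt.
- case: m le_m Sm lt {notSm} => // m le_m /= Sm lt.
  by have := notSp m (introT andP (conj lt le_m)); rewrite Sm.
- case: (after_prev j) le_p Sp lt {notSp} => // p le_p /= Sp lt.
  by have := notSm p (introT andP (conj lt le_p)); rewrite Sp.
Qed.

(** The last clause makes a sequence constant on [S] agree at [i] and [pi i.+1]. *)
Lemma perm_insert : exists pi : nat -> nat,
  [/\ bijective pi, S (pi 0%N)
    & forall i, pi i.+1 = i \/ S i /\ S (pi i.+1)].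
Proof.
have nextP N : [/\ (N <= next N)%N, S (next N)
    & forall k, (N <= k < next N)%N -> ~~ S k].
  rewrite /next; case: ex_minnP => m /andP[le_m Sm] minm; split => // k.
  move=> /andP[le_k lt_k]; apply/negP => Sk.
  by move: (minm k); rewrite le_k Sk leqNgt lt_k => /(_ isT).
pose skip m := (m == 0%N) || S m.-1.
pose pi m := if skip m then next m else m.-1.
exists pi; split.
- exists (fun j => if S j then after_prev j else j.+1).
  + move=> m; rewrite /pi; case: (boolP (skip m)) => skipm.
      by have [? -> ?] := nextP m; exact: after_prev_unique.
    by move: skipm; rewrite negb_or => /andP[+ /negPf ->]; case: m.
  + move=> j; case: ifPn => Sj; last by rewrite /pi /skip /= (negPf Sj).
    have [le_p notS skipp] := after_prevP j.
    rewrite /pi /skip skipp; have [le_n Sn notSn] := nextP (after_prev j).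
    (* Both numbers are the first element of [S] from [after_prev j] on. *)
    case: (ltngtP (next (after_prev j)) j) => // lt.
      by move: (notS _ (introT andP (conj le_n lt))); rewrite Sn.
    by move: (notSn _ (introT andP (conj le_p lt))); rewrite Sj.
- by have [] := nextP 0%N.
- move=> i; rewrite /pi /skip /=; case: ifPn => Si; last by left.
  by right; have [] := nextP i.+1.
Qed.

End PermInsert.

Lemma reindex_automorphism (R : comNzRingType) (pi : nat -> nat) :
  bijective pi -> alg_automorphism (fun x : Pi R => (x \o pi : Pi R)).
Proof.
move=> [pi' piK pi'K]; split; first by split.
exists (fun x : Pi R => (x \o pi' : Pi R)) => x; apply/funext => i /=.
  by rewrite pi'K.
by rewrite piK.
Qed.

Theorem lemma3p13 (R : finComNzRingType) (hR : indecomposable R) :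
  exists eta : Pi R -> Pi R,
    [/\ alg_endomorphism eta,
        eta 1 = 1,
        forall n : nat, (0 < n)%N -> local_automorphism n eta,
        ~ (forall y : Pi R, exists x : Pi R, eta x = y)
      & ~ alg_automorphism eta].
Proof.
have [L LP] := ultralimit R.
pose eta (x : Pi R) : Pi R := fun i => if i is k.+1 then x k else L x.
have L3 (x y z : Pi R) : exists i, [/\ x i = L x, y i = L y & z i = L z].
  (* The default value [z] of [nth] serves as the third sequence. *)
  have [i _ Li] := LP 3%N (fun j : 'I_3 => nth z [:: x; y] j) 0%N.
  exists i; split; [exact: (Li (@Ordinal 3 0 isT)) |
    exact: (Li (@Ordinal 3 1 isT)) | exact: (Li (@Ordinal 3 2 isT))].
have Lconst (c : R) : L (fun=> c) = c by have [i []] := L3 (fun=> c) 0 0.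
have eta_lin : linear eta.
  move=> c x y; apply/funext => -[|//] /=.
  have [i [Lx Ly Lz]] := L3 x y (c *: x + y).
  by rewrite -Lz -[LHS]/(c *: x i + y i) Lx Ly.
have not_onto : ~ (forall y : Pi R, exists x : Pi R, eta x = y).
  (* The indicator of 0 is missed: its zero shift forces [x = 0], whose limit is 0 and not 1. *)
  move=> /(_ (fun i => (i == 0%N)%:R))[x eta_x].
  have x0 : x = (fun=> 0) by apply/funext => i; have := congr1 (@^~ i.+1) eta_x.
  have := congr1 (@^~ 0%N) eta_x.
  by rewrite /= x0 Lconst => /esym/eqP; rewrite GRing.oner_eq0.
exists eta; split => //.
- split=> // x y; apply/funext => -[|//] /=.
  have [i [Lx Ly Lz]] := L3 x y (x * y).
  by rewrite -Lz -[LHS]/(x i * y i) Lx Ly.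
- by apply/funext => -[|//] /=; exact: Lconst.
- move=> n _; split=> // a.
  pose S : pred nat := fun i => [forall j, a j i == L (a j)].
  have S_unbounded N : exists i, (N <= i)%N && S i.
    have [i le_i Li] := LP n a N; exists i; rewrite le_i.
    by apply/forallP => j; apply/eqP.
  have SP i j : S i -> a j i = L (a j) by move=> /forallP/(_ j)/eqP.
  have [pi [pi_bij Spi0 piS]] := perm_insert S S_unbounded.
  exists (fun x : Pi R => (x \o pi : Pi R)); split.
    exact: reindex_automorphism.
  move=> j; apply/funext => -[|i] /=; first by rewrite SP.
  by have [->|[/SP -> /SP ->]] := piS i.
- move=> [_ [g _ gK]]; apply: not_onto => y.
  by exists (g y).
Qed.
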